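(* Let $a,b,c>0$. For $\mathbf{x}=(x,y)\in\overline{\mathbb{R}_+^2}$ and $t>0$ let $$J(\mathbf{x},t)=\inf\left\{\int_0^t\big(L(-\eta(\tau))+F(\gamma,\eta,l)(\tau)\big)\,d\tau\ :\ (\gamma,\eta,l)\in\mathbb{Y}^{\mathbf{x},t},\ \gamma(t)=(0,0)\right\}.$$ Then $$J(\mathbf{x},t)=\varphi^*(\mathbf{x},t)-t,\qquad\text{where}\qquad \varphi^*(\mathbf{x},t)=\min_{s\ge0}\left\{\frac{(-x+bs+ct)^2}{4(t+as)}+\frac{(y+s)^2}{4t}\right\}.$$
   Context: Notation: $\mathbb{R}_+=(0,\infty)$, $\overline{\mathbb{R}_+^2}=\mathbb{R}\times[0,\infty)$. For $q=(q_1,q_2)\in\mathbb{R}^2$, $L(q)=\frac{|q|^2}{4}-\frac{c}{2}q_1+\frac{c^2}{4}-1$; for $q_1\in\mathbb{R}$, $G(q_1)=\frac{(q_1-b)^2}{4a}$. Control triplets: for $\mathbf{x}\in\overline{\mathbb{R}_+^2}$, $t>0$, $\mathbb{Y}^{\mathbf{x},t}$ is the set of triplets $(\gamma,\eta,l)$ with $\gamma=(\gamma_1,\gamma_2)$ absolutely continuous from $[0,t]$ to $\overline{\mathbb{R}_+^2}$, $\eta=(\eta_1,\eta_2)\in L^1([0,t],\mathbb{R}^2)$, $l\in L^1([0,t],\mathbb{R})$, such that: $\gamma(0)=\mathbf{x}$; for a.e. $\tau\in[0,t]$, $l(\tau)\ge0$, and $l(\tau)=0$ if $\gamma_2(\tau)\ne0$;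 the function $F(\gamma,\eta,l)(\tau):=l(\tau)\,G\big(\frac{\eta_1(\tau)-\dot\gamma_1(\tau)}{l(\tau)}\big)$ is integrable on $[0,t]$, where this expression means $\frac{(\eta_1-\dot\gamma_1-bl)^2(\tau)}{4a\,l(\tau)}$ if $l(\tau)>0$ and $0$ if $l(\tau)=0$; for a.e. $\tau$, $\dot\gamma(\tau)=\eta(\tau)$ if $l(\tau)=0$, and $\eta_2(\tau)=\dot\gamma_2(\tau)-l(\tau)$ if $l(\tau)\ne0$. *)

(* Defs.v *)
From HB Require Import structures.
From mathcomp Require Import all_boot all_order all_algebra.
From mathcomp Require Import all_classical all_reals all_analysis.
Set Implicit Arguments.
Unset Strict Implicit.
Unset Printing Implicit Defensive.
Import Order.TTheory GRing.Theory Num.Theory.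
Import numFieldNormedType.Exports.
Local Open Scope classical_set_scope.
Local Open Scope ring_scope.

(* Functions on [0, t] are total functions on R of which only the restriction
   to [0, t] is used.  Every derivative below is taken for almost every time in
   [0, t], hence at interior points, where it depends on that restriction
   only. *)

Definition abs_continuous (R : realType) (u v : R) (f : R -> R) : Prop :=
  forall e : R, 0 < e -> exists2 d : R, 0 < d &
    forall (n : nat) (p q : 'I_n -> R),
      (forall i, [/\ u <= p i, p i < q i & q i <= v]) ->
      trivIset [set: 'I_n] (fun i => `]p i, q i[%classic) ->
      \sum_(i < n) (q i - p i) < d ->
      \sum_(i < n) `|f (q i) - f (p i)| < e.

(* The norm is Euclidean, whereas the library norm on R * R is the sup norm. *)
Definition costL (R : realType) (c : R) (q : R * R) : R :=
  (q.1 ^+ 2 + q.2 ^+ 2) / 4 - c / 2 * q.1 + c ^+ 2 / 4 - 1.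

Definition costG (R : realType) (a b : R) (q1 : R) : R :=
  (q1 - b) ^+ 2 / (4 * a).

Definition costF (R : realType) (a b : R) (gamma eta : R -> R * R) (l : R -> R)
    (tau : R) : R :=
  if 0 < l tau then
    l tau * costG a b
      (((eta tau).1 - derive1 (fun s => (gamma s).1) tau) / l tau)
  else 0.

Record control_triplet (R : realType) (a b : R) (x : R * R) (t : R)
    (gamma eta : R -> R * R) (l : R -> R) : Prop := ControlTriplet {
  ct_gamma_ac1 : abs_continuous 0 t (fun tau => (gamma tau).1);
  ct_gamma_ac2 : abs_continuous 0 t (fun tau => (gamma tau).2);
  ct_gamma_ge0 : forall tau, 0 <= tau <= t -> 0 <= (gamma tau).2;
  ct_eta1_int : (@lebesgue_measure R).-integrable `[0, t]
                  (fun tau => ((eta tau).1)%:E);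
  ct_eta2_int : (@lebesgue_measure R).-integrable `[0, t]
                  (fun tau => ((eta tau).2)%:E);
  ct_l_int : (@lebesgue_measure R).-integrable `[0, t]
               (fun tau => (l tau)%:E);
  ct_gamma0 : gamma 0 = x;
  ct_l_ge0 : {ae (@lebesgue_measure R), forall tau, 0 <= tau <= t ->
    0 <= l tau /\ ((gamma tau).2 != 0 -> l tau = 0)};
  ct_F_int : (@lebesgue_measure R).-integrable `[0, t]
               (fun tau => (costF a b gamma eta l tau)%:E);
  ct_dynamics : {ae (@lebesgue_measure R), forall tau, 0 <= tau <= t ->
    (l tau = 0 ->
       derive1 (fun s => (gamma s).1) tau = (eta tau).1 /\
       derive1 (fun s => (gamma s).2) tau = (eta tau).2) /\
    (l tau != 0 ->
       (eta tau).2 = derive1 (fun s => (gamma s).2) tau - l tau)}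
}.

(* The integrand is bounded below by -1 but need not be integrable, as eta is
   only in L^1, so the action takes values in the extended reals. *)
Definition action (R : realType) (a b c t : R) (gamma eta : R -> R * R)
    (l : R -> R) : \bar R :=
  (\int[@lebesgue_measure R]_(tau in `[0%R, t])
    (costL c (- eta tau)%R + costF a b gamma eta l tau)%R%:E)%E.

Definition value_J (R : realType) (a b c : R) (x : R * R) (t : R) : \bar R :=
  ereal_inf [set v | exists gamma eta l,
    [/\ control_triplet a b x t gamma eta l, gamma t = (0, 0) &
        v = action a b c t gamma eta l]].

Definition phi_cost (R : realType) (a b c : R) (x : R * R) (t s : R) : R :=
  (- x.1 + b * s + c * t) ^+ 2 / (4 * (t + a * s)) +
  (x.2 + s) ^+ 2 / (4 * t).

Definition phi_star (R : realType) (a b c : R) (x : R * R) (t : R) : R :=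
  inf [set phi_cost a b c x t s | s in [set s | 0 <= s]].

(* Main.v *)
Require Import Defs.
From HB Require Import structures.
From mathcomp Require Import all_boot all_order all_algebra.
From mathcomp Require Import all_classical all_reals all_analysis.
From mathcomp Require Import measurable_realfun lra ring.
Import Order.TTheory GRing.Theory Num.Theory.
Import numFieldNormedType.Exports.
Local Open Scope classical_set_scope.
Local Open Scope ring_scope.

(** Why the theorem holds.  With l the reflection term and w := eta_1 - gamma_1',
    the quantity L(-eta) is ((eta_1 + c)^2 + eta_2^2)/4 - 1, and F is
    (w - b l)^2 / (4 a l) where l > 0 and 0 elsewhere.  Both are convex, so for
    each pair of slopes p, q the integrand lies above the supporting affine
    function
      p gamma_1' - q gamma_2' + (p c - p^2 - q^2 - 1) + (p b - a p^2 + q) l,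
    in which the dynamics have eliminated eta (running_cost_ge_affine).
    Along a trajectory from (x, y) to the origin the integrals of gamma_1' and
    gamma_2' are -x and -y, so the integral of this affine function depends on
    the trajectory only through s := int_0^t l.  The slopes
      p = (-x + b s + c t) / (2 (t + a s)),   q = (y + s) / (2 t)
    maximise it over p and q, and the maximum is phi_cost s - t.  Hence the
    action of any admissible triplet is at least phi_cost s - t for its own s
    (action_ge).

    Conversely, given s >= 0, equality in these convexity inequalities forces
    eta = (2p - c, -2q), hence a trajectory that descends at the constant speed
    2q, reaches the boundary, and slides along it with l = 2q until time t.
    That triplet is admissible and its action is exactly phi_cost s - t
    (reflected_trajectory).  As phi_cost is continuous and grows quadratically
    on [0, +oo[, it attains its minimum there (phi_cost_min), and the two
    bounds meet at the minimiser.

    The analytic substance is the identity int_0^t gamma_i' = gamma_i(t) -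
    gamma_i(0) for an absolutely continuous gamma_i, together with the existence
    of the derivative almost everywhere: Lebesgue's fundamental theorem of
    calculus.  It is obtained as follows.  The total variation T of an
    absolutely continuous f is absolutely continuous, so that f = T - (T - f)
    is a difference of nondecreasing functions with the same property.  The
    Lebesgue-Stieltjes measure of such a function vanishes on Lebesgue-null
    sets, and its Radon-Nikodym density g satisfies f(x) - f(u) =
    int_u^x g (abs_continuous_density).  Lebesgue's differentiation theorem
    then gives f' = g almost everywhere (density_derive1). *)

(** * Finite families of disjoint intervals and total variation *)

Section families.
Context {R : realType}.
Set Implicit Arguments.
Unset Strict Implicit.
Unset Printing Implicit Defensive.
Implicit Types (u v e : R) (f : R -> R) (s : seq (R * R)).

(** Families of intervals are sequences of pairs, because refining an interval by
    the intervals of a partition is then a concatenation. *)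
Definition separated (x y : R * R) : bool := (x.2 <= y.1) || (y.2 <= x.1).

Definition itv_family u v s : bool :=
  all (fun x => [&& u <= x.1, x.1 < x.2 & x.2 <= v]) s && pairwise separated s.

Definition family_length s : R := \sum_(x <- s) (x.2 - x.1).

Definition family_oscillation f s : R := \sum_(x <- s) `|f x.2 - f x.1|.

(** Absolute continuity, with the disjoint families encoded as sequences. *)
Definition family_abs_continuous u v f := forall e, 0 < e ->
  exists2 d, 0 < d & forall s, itv_family u v s ->
    family_length s < d -> family_oscillation f s < e.

Lemma itv_family_cat u v s1 s2 : itv_family u v (s1 ++ s2) =
  [&& itv_family u v s1, itv_family u v s2 & allrel separated s1 s2].
Proof.
rewrite /itv_family all_cat pairwise_cat.
case: (all _ s1); rewrite ?andbF //=; case: (all _ s2); rewrite ?andbF //=.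
by case: (allrel _ _ _); rewrite ?andbF ?andbT.
Qed.

Lemma abs_continuous_family u v f : abs_continuous u v f ->
  family_abs_continuous u v f.
Proof.
move=> acf e /acf[d d0 H]; exists d => // s /andP[/allP s1 /(pairwiseP (0, 0)) s2].
rewrite /family_length /family_oscillation !(big_tnth _ _ s).
apply: H => [i|]; first by have /s1/and3P[] := mem_tnth i (in_tuple s).
move=> i j _ _ [z []]/=; rewrite !in_itv /= => /andP[h1 h2] /andP[h3 h4].
apply/eqP; case: (ltgtP i j) => // ij.
- have := s2 i j (ltn_ord i) (ltn_ord j) ij.
  rewrite -!(tnth_nth _ (in_tuple s)) /separated => /orP[] h; exfalso; lra.
- have := s2 j i (ltn_ord j) (ltn_ord i) ij.
  rewrite -!(tnth_nth _ (in_tuple s)) /separated => /orP[] h; exfalso; lra.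
Qed.

Lemma itv_family_partition u v (s : seq R) : itv_partition u v s ->
  [/\ itv_family u v (zip (u :: s) s), family_length (zip (u :: s) s) = v - u &
  forall f, family_oscillation f (zip (u :: s) s) = variation u v f s].
Proof.
elim: s u => [|h s ih] u.
  by move=> /itv_partition_nil ->; rewrite /itv_family /family_length
    /family_oscillation/=; split=> [//||f]; rewrite !big_nil ?subrr// variation_nil.
move=> [/= /andP[uh ps] /eqP hv].
have hsv : itv_partition h v s by split=> //; apply/eqP.
have [/andP[fa fp] fl fo] := ih h hsv.
have hlv := itv_partition_le hsv.
split.
- rewrite /itv_family /= lexx uh hlv fp andbT /=; apply/andP; split.
    by apply: sub_all fa => x /and3P[? -> ->]; rewrite andbT (le_trans (ltW uh)).
  rewrite andbT; apply: sub_all fa => x /and3P[? _ _].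
  by rewrite /separated /=; apply/orP; left.
- by rewrite /family_length big_cons/= -/(family_length _) fl; ring.
- move=> f; rewrite /family_oscillation big_cons -/(family_oscillation _ _) fo.
  rewrite /variation big_nat_recl//=; congr (_ + _).
Qed.

Lemma itv_family_widen u v u' v' s : u' <= u -> v <= v' ->
  itv_family u v s -> itv_family u' v' s.
Proof.
move=> uu vv /andP[sa sp]; rewrite /itv_family sp andbT; apply: sub_all sa.
by move=> x /and3P[h1 -> h2]; rewrite (le_trans uu h1) (le_trans h2 vv).
Qed.

(** For the d attached to the oscillation 1, an interval shorter than d has
    variation at most 1, since each of its partitions is an admissible family;
    [u, v] is covered by finitely many steps of length d / 2. *)
Lemma abs_continuous_bounded_variation u v f : u <= v -> abs_continuous u v f ->
  bounded_variation u v f.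
Proof.
move=> uv /abs_continuous_family/(_ 1 ltr01)[d d0 H].
have small x y : u <= x -> x <= y -> y <= v -> y - x < d -> bounded_variation x y f.
  move=> ux xy yv xyd; exists 1 => _ [s /itv_family_partition[h1 h2 h3] <-].
  by rewrite -h3 ltW// H ?h2//; exact: itv_family_widen h1.
suff step : forall n : nat, forall x, u <= x -> x <= v -> x - u <= n%:R * (d / 2) ->
    bounded_variation u x f.
  apply: (step (Num.truncn ((v - u) / (d / 2))).+1) => //.
  by rewrite -ler_pdivrMr ?divr_gt0// ltW// truncnS_gt.
elim=> [|n ih] x ux xv xu.
  have -> : x = u by lra.
  exact: bounded_variationxx.
have [xd|dx] := lerP (x - d / 2) u; first by apply: small => //; lra.
have ux' : u <= x - d / 2 by exact: ltW.
have x'x : x - d / 2 <= x by lra.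
apply/bounded_variationP => //; rewrite (total_variationD _ ux' x'x).
rewrite fin_numD; apply/andP; split; apply/bounded_variationP => //.
  by apply: ih => //; [lra|rewrite -natr1 mulrDl mul1r in xu; lra].
by apply: small => //; lra.
Qed.

Lemma total_variation_approx x y f e : x <= y -> bounded_variation x y f -> 0 < e ->
  exists2 s, itv_partition x y s & fine (total_variation x y f) - e < variation x y f s.
Proof.
move=> xy /(bounded_variationP _ xy) fin e0.
have : (total_variation x y f - e%:E < total_variation x y f)%E.
  by rewrite lteBlDr// lteDl// lte_fin.
move/ereal_sup_gt => [_ [_ [s sp <-] <-] H]; exists s => //.
by rewrite -lte_fin EFinB fineK.
Qed.

(** Each interval of the family is replaced by a partition that nearly realises
    the variation of f on it.  The total length does not change, so smallness of
    the oscillation of f over the refined family bounds the increments of the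
    total variation over the original one.  The last clause, that the new
    intervals lie in old ones, keeps the pieces separated in the induction. *)
Lemma family_refine_variation u v f s e : bounded_variation u v f ->
  itv_family u v s -> 0 < e ->
  exists s', [/\ itv_family u v s', family_length s' = family_length s,
    family_oscillation (fun x => fine (total_variation u x f)) s - e
      <= family_oscillation f s' &
    forall x', x' \in s' -> exists2 x, x \in s & x.1 <= x'.1 /\ x'.2 <= x.2].
Proof.
move=> bv; elim: s e => [|[p q] s ih] e fs e0.
  exists [::]; split => //.
  by rewrite /family_oscillation !big_nil; lra.
move: fs; rewrite -cat1s itv_family_cat => /and3P[fpq fs sp].
have [s' [fs' ls' os' ss']] := ih (e / 2) fs ltac:(lra).
have {fpq}[up pq qv] : [/\ u <= p, p < q & q <= v].
  by move: fpq; rewrite /itv_family /= !andbT => /and3P[].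
have uq : u <= q by lra.
have pv : p <= v by lra.
have bvq : bounded_variation u q f by exact: bounded_variationl bv.
have bvpq : bounded_variation p q f by apply: bounded_variationr bvq => //; lra.
have [r rp r_var] := @total_variation_approx p q f (e / 2) (ltW pq) bvpq ltac:(lra).
have [fr lr or] := itv_family_partition rp.
set s1 := zip (p :: r) r in fr lr or.
have s1pq x' : x' \in s1 -> p <= x'.1 /\ x'.2 <= q.
  by move: fr => /andP[/allP H _] /H /and3P[].
exists (s1 ++ s'); split.
- rewrite itv_family_cat fs' (itv_family_widen up qv fr)/=.
  apply/allrelP => x' y' /s1pq[px xq] /ss'[y ys [yy yy']].
  have := allrelP sp (p, q) y (mem_head _ _) ys.
  by rewrite /separated /= => /orP[h|h]; apply/orP; [left|right]; lra.
- by rewrite /family_length big_cat /= big_cons /= -!/(family_length _) lr ls'.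
- have -> : family_oscillation f (s1 ++ s') = variation p q f r + family_oscillation f s'.
    by rewrite -or /family_oscillation big_cat.
  rewrite {1}/family_oscillation big_cons /= -/(family_oscillation _ _).
  suff -> : `|fine (total_variation u q f) - fine (total_variation u p f)|
     = fine (total_variation p q f).
    by rewrite -/(family_oscillation (fun x => fine (total_variation u x f)) s); lra.
  rewrite (total_variationD _ up (ltW pq)) fineD; last 2 first.
  + by apply/bounded_variationP => //; apply: bounded_variationl bv.
  + by apply/bounded_variationP => //; apply: ltW.
  rewrite addrAC subrr add0r ger0_norm// fine_ge0//.
  by apply: total_variation_ge0; apply: ltW.
- move=> x'; rewrite mem_cat => /orP[/s1pq ?|/ss'[x xs xx]].
  + by exists (p, q) => //; rewrite mem_head.
  + by exists x => //; rewrite inE xs orbT.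
Qed.

Lemma total_variation_abs_continuous u v f : u <= v -> abs_continuous u v f ->
  family_abs_continuous u v (fun x => fine (total_variation u x f)).
Proof.
move=> uv acf e e0; have bv := abs_continuous_bounded_variation uv acf.
have [d d0 H] := abs_continuous_family acf (divr_gt0 e0 (ltr0Sn R 1)).
exists d => // s fs sd.
have [s' [fs' ls' os' _]] := family_refine_variation bv fs (divr_gt0 e0 (ltr0Sn R 1)).
have := H s' fs'; rewrite ls' => /(_ sd) ?; lra.
Qed.

Lemma family_abs_continuousB u v f g : family_abs_continuous u v f ->
  family_abs_continuous u v g -> family_abs_continuous u v (f \- g).
Proof.
move=> cf cg e e0; have e20 : 0 < e / 2 by lra.
have [d1 d10 H1] := cf _ e20; have [d2 d20 H2] := cg _ e20.
exists (Num.min d1 d2); first by rewrite lt_min d10.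
move=> s fs; rewrite lt_min => /andP[/(H1 _ fs) h1 /(H2 _ fs) h2].
apply: (@le_lt_trans _ _ (family_oscillation f s + family_oscillation g s)); last lra.
rewrite /family_oscillation -big_split; apply: ler_sum => x _ /=.
apply: le_trans (ler_normB _ _); rewrite le_eqVlt; apply/orP; left; apply/eqP.
by congr (`|_|); ring.
Qed.

End families.

(** * Densities of absolutely continuous functions *)

Section density.
Context {R : realType}.
Set Implicit Arguments.
Unset Strict Implicit.
Unset Printing Implicit Defensive.
Implicit Types (u v e : R) (f F : R -> R).
Local Notation mu := (@lebesgue_measure R).

Lemma open_interval_inf_sup (I : set R) : open I -> is_interval I ->
  has_lbound I -> has_ubound I -> I = `]inf I, sup I[%classic.
Proof.
move=> oI iI lI uI; rewrite -[LHS]/I; have /interior_id := oI => {1}<-.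
by rewrite interval_bounded_interior// set_itvoo.
Qed.

(** An open V is a countable union of disjoint open intervals ]p n, q n[.  Finitely
    many of them form a family of total length at most mu V < d, so their
    nu-measure is at most e, and nu V is the supremum of these finite sums. *)
Lemma open_measure_le (nu : {measure set (measurableTypeR R) -> \bar R})
    u v F e d (V : set R) :
  (forall s, itv_family u v s -> family_length s < d -> family_oscillation F s < e) ->
  (forall p q, u <= p -> p < q -> q <= v -> (nu `]p, q[%classic <= (F q - F p)%:E)%E) ->
  open V -> V `<=` `]u, v[ -> (mu V < d%:E)%E -> (nu V <= e%:E)%E.
Proof.
move=> HF nuF oV Vuv Vd.
pose I := open_disjoint_itv oV.
have oI n : open (I n) by exact: open_disjoint_itv_open.
have mI n : measurable (I n) by exact: open_measurable.
have tI : trivIset setT I by exact: open_disjoint_itv_trivIset.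
have VI : V = \bigcup_n I n by exact: open_disjoint_itv_bigcup.
have Iuv n : I n `<=` `]u, v[.
  by apply: subset_trans Vuv; rewrite VI; exact: bigcup_sup.
pose p n := inf (I n); pose q n := sup (I n).
have Ipq n : I n = `]p n, q n[%classic.
  apply: open_interval_inf_sup => //; first exact: open_disjoint_itv_is_interval.
  - by exists u => x /Iuv; rewrite /= in_itv /= => /andP[/ltW].
  - by exists v => x /Iuv; rewrite /= in_itv /= => /andP[_ /ltW].
(* The decomposition may contain empty intervals, which no family may. *)
pose ne n := p n < q n.
have pquv n : ne n -> u <= p n /\ q n <= v.
  rewrite /ne => pq; have Ine : I n !=set0.
    by exists ((p n + q n) / 2); rewrite Ipq /= in_itv /=; apply/andP; split; lra.
  split; first by apply: lb_le_inf => // x /Iuv; rewrite /= in_itv /= => /andP[/ltW].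
  by apply: sup_le_ub => // x /Iuv; rewrite /= in_itv /= => /andP[_ /ltW].
pose fam N := [seq (p n, q n) | n <- index_iota 0 N & ne n].
have sumI (m : {measure set (measurableTypeR R) -> \bar R}) N :
    (\sum_(0 <= n < N) m (I n) = \sum_(0 <= n < N | ne n) m `]p n, q n[%classic)%E.
  rewrite [RHS]big_mkcond; apply: eq_bigr => n _; case: ifPn => pq; first by rewrite -Ipq.
  by rewrite Ipq set_itv_ge ?measure0// bnd_simp.
have famP N : itv_family u v (fam N).
  apply/andP; split.
    rewrite all_map; apply/allP => n; rewrite mem_filter => /andP[pq _] /=.
    by have [-> ->] := pquv n pq; rewrite [p n < q n]pq.
  rewrite pairwise_map.
  apply: (@sub_in_pairwise _ ne [rel x y | x != y]); last 2 first.
  - exact: filter_all.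
  - by rewrite -uniq_pairwise filter_uniq// iota_uniq.
  move=> n m; rewrite /in_mem /= /ne => pqn pqm nm.
  rewrite /separated /= leNgt [X in _ || X]leNgt -negb_and.
  apply/negP => /andP[pmqn pnqm].
  have := trivIsetP.1 tI n m Logic.I Logic.I nm.
  rewrite !Ipq => /seteqP[+ _] => /(_ ((Num.max (p n) (p m) + Num.min (q n) (q m)) / 2)).
  apply; split; rewrite /= in_itv /=;
    case: (lerP (p n) (p m)) => ?; case: (lerP (q n) (q m)) => ?; apply/andP; split; lra.
have lenV N : (\sum_(0 <= n < N) mu (I n) <= mu V)%E.
  rewrite VI measure_semi_bigcup//; last by rewrite -VI; exact: open_measurable.
  by apply: nneseries_lim_ge.
rewrite VI measure_semi_bigcup//; last by rewrite -VI; exact: open_measurable.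
apply: lime_le; first by apply: is_cvg_nneseries.
near=> N; rewrite sumI.
apply: (@le_trans _ _ (family_oscillation F (fam N))%:E); last first.
  rewrite lee_fin ltW// HF// -lte_fin; apply: le_lt_trans Vd; apply: le_trans (lenV N).
  rewrite sumI /family_length big_map big_filter -sumEFin; apply: lee_sum => n pq.
  by rewrite [leRHS](lebesgue_measure_itv `]p n, q n[) /= lte_fin [p n < q n]pq EFinB.
rewrite /family_oscillation big_map big_filter -sumEFin; apply: lee_sum => n pq.
have [up qv] := pquv n pq; apply: (le_trans (nuF _ _ up pq qv)).
by rewrite lee_fin ler_norm.
Unshelve. all: by end_near. Qed.

Lemma family_abs_continuous_uniform u v F e : family_abs_continuous u v F -> 0 < e ->
  exists2 d, 0 < d & forall x y, u <= x -> x <= y -> y <= v -> y - x < d ->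
    `|F y - F x| < e.
Proof.
move=> cF e0; have [d d0 H] := cF e e0; exists d => // x y ux xy yv yxd.
have [->|xney] := eqVneq x y; first by rewrite subrr normr0.
have := H [:: (x, y)]; rewrite /itv_family /family_length /family_oscillation.
by rewrite !big_seq1 /= ux yv lt_neqAle xney xy; apply.
Qed.

(** Composition with clamp turns a function on [u, v] into one on the whole line
    that is constant on both sides, as a Lebesgue-Stieltjes measure requires. *)
Definition clamp u v x := Num.max u (Num.min x v).

Lemma clampP u v x : u <= v -> u <= clamp u v x <= v.
Proof.
by move=> uv; rewrite /clamp le_max lexx ge_max uv ge_min lexx orbT.
Qed.

Lemma clamp_id u v x : u <= x <= v -> clamp u v x = x.
Proof. by rewrite /clamp => /andP[ux xv]; rewrite (min_idPl xv) (max_idPr ux). Qed.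

Lemma clamp_lip u v x y : u <= v -> x <= y ->
  clamp u v x <= clamp u v y <= clamp u v x + (y - x).
Proof.
by rewrite /clamp => uv xy; case: (lerP x v) => ?; case: (lerP y v) => ?;
  case: (lerP u x) => ?; case: (lerP u y) => ?; case: (lerP u v) => ?;
  apply/andP; split; lra.
Qed.

(** The Lebesgue-Stieltjes measure nu of F on ]u, v] vanishes on Lebesgue-null
    sets: such a set has open neighbourhoods of arbitrarily small length, and
    their nu-measure is then small by absolute continuity.  The Radon-Nikodym
    density of nu is the density of F. *)
Lemma nondecreasing_density u v F : u < v ->
  {in `[u, v] &, nondecreasing_fun F} -> family_abs_continuous u v F ->
  exists g : R -> R, mu.-integrable setT (EFin \o g) /\
    forall x, u <= x <= v ->
      (F x - F u)%:E = (\int[mu]_(y in `]u, x]) (g y)%:E)%E.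
Proof.
move=> uv ndF cF.
pose G x := F (clamp u v x).
have cuv x : clamp u v x \in `[u, v] by rewrite in_itv /=; apply: clampP; lra.
have ndG : nondecreasing G.
  move=> x y xy; apply: ndF; rewrite ?cuv//.
  by have /andP[] := clamp_lip (ltW uv) xy.
have rcG : right_continuous G.
  move=> x; apply/cvgrPdist_lt => e e0.
  have [d d0 H] := family_abs_continuous_uniform cF e0.
  near=> y; have xy : x <= y by near: y; apply: nbhs_right_ge.
  have /andP[xy1 xy2] := clamp_lip (ltW uv) xy.
  rewrite distrC; apply: H => //; [by case/andP: (clampP x (ltW uv))| |].
    by case/andP: (clampP y (ltW uv)).
  have : y < x + d by near: y; apply: nbhs_right_lt; rewrite ltrDl.
  lra.
pose H : cumulative R R := HB.pack G (isCumulative.Build R _ R G ndG rcG).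
pose nu := lebesgue_stieltjes_measure H.
have nuE p q : p <= q -> nu `]p, q]%classic = (G q - G p)%:E.
  move=> pq; rewrite /nu /lebesgue_stieltjes_measure /measure_extension.
  by rewrite measurable_mu_extE/= ?wlength_itv_bnd//; exact: is_ocitv.
have mD : measurable (`]u, v]%classic : set (measurableTypeR R)) by exact: measurable_itv.
have nuD : (nu `]u, v]%classic < +oo)%E by rewrite nuE ?ltry// ltW.
have GF x : u <= x <= v -> G x = F x by move=> ?; rewrite /G clamp_id.
have nuF p q : u <= p -> p < q -> q <= v -> (nu `]p, q[%classic <= (F q - F p)%:E)%E.
  move=> up pq qv; rewrite -(GF p) -?(GF q); [|lra|lra].
  rewrite -nuE; last lra.
  apply: le_measure; rewrite ?inE; [exact: measurable_itv|exact: measurable_itv|].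
  by apply: subset_itvl; rewrite bnd_simp.
have dom : mfrestr mD nuD `<< mu.
  apply/null_content_dominatesP => A mA A0; rewrite /mfrestr /mrestr.
  apply/eqP; rewrite eq_le measure_ge0 andbT; apply/lee_addgt0Pr => e e0.
  have e20 : 0 < e / 2 by lra.
  have [d d0 Hd] := cF _ e20.
  have [d' d'0 Hd'] := family_abs_continuous_uniform cF e20.
  have Aoo : (mu A < +oo)%E by rewrite [ltLHS]A0 ltry.
  have [U [oU AU Ud]] := lebesgue_regularity_outer mA Aoo d0.
  have mU : measurable (U : set (measurableTypeR R)) by exact: open_measurable.
  (* The right end v is not in the open set V; it is covered by the short
     interval ]w, v], on which F grows by less than e / 2. *)
  pose V := U `&` `]u, v[.
  have oV : open V by apply: openI => //; exact: (@interval_open _ (BRight _) (BLeft _)).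
  have Vd : (mu V < d%:E)%E.
    apply: le_lt_trans Ud; apply: (@le_trans _ _ (mu U)).
      by apply: le_measure; rewrite ?inE//; [exact: open_measurable|exact: subIsetl].
    have -> : (mu U = mu (U `\` A) + mu (U `&` A))%E by exact: measureDI.
    have -> : mu (U `&` A) = 0%E.
      by apply: (@subset_measure0 _ _ _ mu _ A) => //; exact: measurableI.
    by rewrite adde0.
  pose w := Num.max u (v - d' / 2).
  have uw : u <= w by rewrite /w le_max lexx.
  have wv : w < v by rewrite /w gt_max uv; lra.
  have wd : v - w < d' by rewrite ltrBlDr /w -ltrBlDl lt_max; apply/orP; right; lra.
  apply: (@le_trans _ _ (nu (V `|` `]w, v]%classic))).
    apply: le_measure; rewrite ?inE.
    - exact: measurableI.
    - by apply: measurableU; [exact: open_measurable|exact: measurable_itv].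
    - move=> x [/AU Ux]; rewrite /V /= !in_itv /= => /andP[ux].
      rewrite le_eqVlt => /predU1P[xv|xv].
        by right; rewrite xv wv eqxx.
      by left; split => //; rewrite ux xv.
  apply: (@le_trans _ _ (nu V + nu `]w, v]%classic)%E).
    by apply: measureU2; [exact: open_measurable|exact: measurable_itv].
  rewrite add0e [e in leRHS](_ : e = e / 2 + e / 2); last lra.
  rewrite EFinD; apply: leeD.
    by apply: (open_measure_le Hd nuF oV) => // x [].
  rewrite nuE ?(ltW wv)// !GF ?lexx ?(ltW uv) ?uw ?(ltW wv)//.
  rewrite lee_fin; apply: le_trans (ler_norm _) _; apply: ltW.
  by apply: Hd' => //; exact: ltW.
have [g [g0 gfin gint gE]] := radon_nikodym_sigma_finite dom.
exists (fine \o g); split.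
  by apply: eq_integrable gint => // x _ /=; rewrite fineK.
move=> x uxv; have /andP[ux xv] := uxv.
rewrite -(GF x uxv) -(GF u); last by rewrite lexx ltW.
rewrite -nuE//.
transitivity (mfrestr mD nuD `]u, x]%classic).
  rewrite /mfrestr /mrestr setIidl//.
  by apply: subset_itvl; rewrite bnd_simp.
rewrite gE; last exact: measurable_itv.
by apply: eq_integral => y _ /=; rewrite fineK.
Unshelve. all: by end_near. Qed.

(** f = T - (T - f) with T the total variation from u: both terms are
    nondecreasing because |f y - f x| <= T y - T x. *)
Lemma abs_continuous_density u v f : u < v -> abs_continuous u v f ->
  exists g : R -> R, mu.-integrable setT (EFin \o g) /\
    forall x, u <= x <= v ->
      (f x - f u)%:E = (\int[mu]_(y in `]u, x]) (g y)%:E)%E.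
Proof.
move=> uv acf; have bv := abs_continuous_bounded_variation (ltW uv) acf.
pose T x := fine (total_variation u x f).
have cT : family_abs_continuous u v T by exact: total_variation_abs_continuous (ltW uv) acf.
have cTf : family_abs_continuous u v (T \- f).
  by apply: family_abs_continuousB => //; exact: abs_continuous_family.
have TD x y : u <= x -> x <= y -> y <= v ->
    `|f y - f x| <= T y - T x.
  move=> ux xy yv; have bxy : bounded_variation x y f.
    by apply: (bounded_variationr ux xy); apply: (bounded_variationl _ yv) => //; lra.
  rewrite /T (total_variationD _ ux xy) fineD; last 2 first.
  - by apply/bounded_variationP => //; apply: bounded_variationl bv; lra.
  - exact/bounded_variationP.
  rewrite addrAC subrr add0r -lee_fin fineK; last exact/bounded_variationP.
  exact: total_variation_ge.
have ndT : {in `[u, v] &, nondecreasing_fun T}.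
  move=> x y; rewrite !in_itv /= => /andP[ux xv] /andP[uy yv] xy.
  by rewrite -subr_ge0; apply: le_trans (TD x y ux xy yv).
have ndTf : {in `[u, v] &, nondecreasing_fun (T \- f)}.
  move=> x y; rewrite !in_itv /= => /andP[ux xv] /andP[uy yv] xy.
  have := le_trans (ler_norm _) (TD x y ux xy yv); lra.
have [g1 [ig1 g1E]] := nondecreasing_density uv ndT cT.
have [g2 [ig2 g2E]] := nondecreasing_density uv ndTf cTf.
exists (g1 \- g2); split.
  exact: integrableB ig1 ig2.
move=> x uxv.
transitivity ((T x - T u)%:E - ((T \- f) x - (T \- f) u)%:E)%E.
  by rewrite -EFinB /=; congr EFin; ring.
rewrite (g1E _ uxv) (g2E _ uxv) -integralB//=.
- exact: (integrableS measurableT).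
- exact: (integrableS measurableT).
Qed.

(** Lebesgue's differentiation theorem: near each x in ]u, v[, f is a constant plus
    an indefinite integral of g. *)
Lemma density_derive1 u v f (g : R -> R) :
  mu.-integrable setT (EFin \o g) ->
  (forall x, u <= x <= v -> (f x - f u)%:E = (\int[mu]_(y in `]u, x]) (g y)%:E)%E) ->
  {ae mu, forall x, u < x < v -> derive1 f x = g x}.
Proof.
move=> ig fE.
have lg : locally_integrable setT g by exact: open_integrable_locally openT ig.
have ig' y : mu.-integrable `]u, y] (EFin \o g) by exact: (integrableS measurableT).
have := @FTC1 R g (BRight u) ig' lg.
apply: filterS; first exact: (ae_filter_ringOfSetsType mu).
move=> x /= H /andP[ux xv].
have [dF <-] := H ux.
set F := fun x => _ in dF *.
rewrite !derive1E (@near_eq_derive _ _ _ f (cst (f u) + F)).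
  by rewrite deriveD// derive_cst add0r.
near=> y; have uy : u <= y <= v.
  have : u < y by near: y; exact: lt_nbhsr.
  have : y < v by near: y; exact: lt_nbhsl.
  by move=> yv uy; rewrite !ltW.
rewrite /= /F /Rintegral -[f y](subrK (f u)) addrC; congr (_ + _).
by rewrite -fE.
Unshelve. all: by end_near. Qed.

End density.

(** * The lower bound *)

Section lower_bound.
Context {R : realType}.
Set Implicit Arguments.
Unset Strict Implicit.
Unset Printing Implicit Defensive.
Local Notation mu := (@lebesgue_measure R).

(** The integrand of the action is bounded below but possibly not integrable, so
    the positive and the negative parts are compared separately. *)
Lemma ae_le_integral (D : set R) (f g : R -> \bar R) :
  measurable D -> measurable_fun D f -> measurable_fun D g ->
  {ae mu, forall x, D x -> (g x <= f x)%E} ->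
  (\int[mu]_(x in D) g x <= \int[mu]_(x in D) f x)%E.
Proof.
move=> mD mf mg gf.
rewrite [leLHS]integralE [leRHS]integralE; apply: leeB.
  apply: ae_ge0_le_integral => //; [exact: measurable_funepos..|].
  apply: filterS gf => [|x H /H gfx]; first exact: (ae_filter_ringOfSetsType mu).
  by rewrite !funeposE ge_max !le_max gfx lexx orbT.
apply: ae_ge0_le_integral => //; [exact: measurable_funeneg..|].
apply: filterS gf => [|x H /H gfx]; first exact: (ae_filter_ringOfSetsType mu).
by rewrite !funenegE ge_max !le_max leeN2 gfx lexx orbT.
Qed.

(** The difference of the two sides is a sum of squares:
      ((eta_1 + c)/2 - p)^2 + (eta_2/2 + q)^2
        + l/(4a) ((eta_1 - d1)/l - b + 2pa)^2,
    the last term being absent when l = 0.  Here d1, d2 stand for the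
    derivatives of gamma. *)
Lemma running_cost_ge_affine (a b c p q d1 d2 l : R) (eta : R * R) :
  0 < a -> 0 <= l ->
  (l = 0 -> d1 = eta.1 /\ d2 = eta.2) -> (l != 0 -> eta.2 = d2 - l) ->
  p * d1 - q * d2 + (p * c - p ^+ 2 - q ^+ 2 - 1) + (p * b - a * p ^+ 2 + q) * l
  <= costL c (- eta) + (if 0 < l then l * costG a b ((eta.1 - d1) / l) else 0).
Proof.
case: eta => e1 e2 a0 l0 free refl; rewrite /costL /costG /= in free refl *.
have key : 0 <= ((e1 + c) / 2 - p) ^+ 2 + (e2 / 2 + q) ^+ 2.
  by rewrite addr_ge0 ?sqr_ge0.
have [l_eq0|l_neq0] := eqVneq l 0.
  have [-> ->] := free l_eq0; rewrite l_eq0 ltxx.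
  rewrite -subr_ge0; apply: le_trans key _; rewrite le_eqVlt; apply/orP; left.
  by apply/eqP; field.
have l_gt0 : 0 < l by rewrite lt_def l_neq0.
rewrite l_gt0 (refl l_neq0) in key *.
rewrite -subr_ge0.
have key2 : 0 <= l / (4 * a) * ((e1 - d1) / l - b + 2 * p * a) ^+ 2.
  by rewrite mulr_ge0 ?sqr_ge0// divr_ge0// ?mulr_ge0// ltW.
apply: le_trans (addr_ge0 key key2) _; rewrite le_eqVlt; apply/orP; left.
by apply/eqP; field; rewrite l_neq0 gt_eqF.
Qed.

Lemma integral_itvcc_oc (u v : R) (g : R -> R) :
  mu.-integrable setT (EFin \o g) ->
  (\int[mu]_(y in `]u, v]) (g y)%:E = \int[mu]_(y in `[u, v]) (g y)%:E)%E.
Proof.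
move=> ig; apply: integral_itv_obnd_cbnd.
by apply: (@measurable_int _ _ _ mu); exact: (integrableS measurableT).
Qed.

Lemma ae_neq (r : R) : {ae mu, forall z, z != r}.
Proof.
exists [set r]; split; [exact: measurable_set1|exact: lebesgue_measure_set1|].
by move=> z /= /negP; rewrite negbK => /eqP.
Qed.

(** The affine minorant is integrated along the trajectory, with s := int_0^t l and
    the slopes p and q optimal for this s. *)
Lemma action_ge (a b c x y t : R) gamma eta l : 0 < a -> 0 < t ->
  control_triplet a b (x, y) t gamma eta l -> gamma t = (0, 0) ->
  exists2 s, 0 <= s & ((phi_cost a b c (x, y) t s - t)%:E <= action a b c t gamma eta l)%E.
Proof.
move=> a0 t0 [ac1 ac2 _ ie1 ie2 il gamma0 l_ge0 iF dyn] gammat.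
have [g1 [ig1 g1E]] := abs_continuous_density t0 ac1.
have [g2 [ig2 g2E]] := abs_continuous_density t0 ac2.
have dg1 := density_derive1 ig1 g1E.
have dg2 := density_derive1 ig2 g2E.
have ttt : 0 <= t <= t by rewrite lexx ltW.
have := g1E t ttt; have := g2E t ttt.
rewrite gamma0 gammat /= !integral_itvcc_oc// => {g2E}g2E {g1E}g1E.
have mI : measurable (`[0, t]%classic : set (measurableTypeR R)) by exact: measurable_itv.
have ilE : (\int[mu]_(z in `[0%R, t]) (l z)%:E = (\int[mu]_(z in `[0%R, t]) l z)%:E)%E.
  by rewrite /Rintegral fineK//; exact: integrable_fin_num.
set s := (\int[mu]_(z in `[0%R, t]) l z)%R in ilE.
have s0 : 0 <= s.
  rewrite -lee_fin -ilE -[leLHS](@integral0 _ _ _ mu `[0%R, t]%classic).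
  apply: ae_le_integral => //.
  - exact: measurable_int il.
  - apply: filterS l_ge0; first exact: (ae_filter_ringOfSetsType mu).
    by move=> z /= + zI; move: zI; rewrite in_itv /= => zI /(_ zI)[]; rewrite lee_fin.
exists s => //.
have tas : 0 < t + a * s by rewrite ltr_wpDr// mulr_ge0// ltW.
pose p := (- x + b * s + c * t) / (2 * (t + a * s)); pose q := (y + s) / (2 * t).
pose k := p * c - p ^+ 2 - q ^+ 2 - 1; pose m := p * b - a * p ^+ 2 + q.
have ig1' : mu.-integrable `[0%R, t] (EFin \o g1) by exact: (integrableS measurableT).
have ig2' : mu.-integrable `[0%R, t] (EFin \o g2) by exact: (integrableS measurableT).
pose G z := p * g1 z + (- q) * g2 z + k + m * l z.
have iZ r h : mu.-integrable `[0%R, t] (EFin \o h) ->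
    mu.-integrable `[0%R, t] (EFin \o (fun z => r * h z)).
  by move=> ih; exact: (integrableZl mI r ih).
have iD h1 h2 : mu.-integrable `[0%R, t] (EFin \o h1) ->
    mu.-integrable `[0%R, t] (EFin \o h2) ->
    mu.-integrable `[0%R, t] (EFin \o (fun z => h1 z + h2 z)).
  by move=> ih1 ih2; exact: (integrableD mI ih1 ih2).
have ik : mu.-integrable `[0%R, t] (EFin \o (fun=> k)).
  apply: measurable_bounded_integrable => //; last first.
    by exists `|k|; split; [exact: num_real|move=> r kr z _ /=; exact: ltW].
  by rewrite [ltLHS](lebesgue_measure_itv `[0, t]) /= lte_fin t0 ltry.
have iG : mu.-integrable `[0%R, t] (EFin \o G).
  exact: (iD _ _ (iD _ _ (iD _ _ (iZ p _ ig1') (iZ (- q) _ ig2')) ik) (iZ m _ il)).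
have -> : (phi_cost a b c (x, y) t s - t)%:E = (\int[mu]_(z in `[0%R, t]) (G z)%:E)%E.
  rewrite -[RHS]fineK; last exact: integrable_fin_num.
  rewrite -/(Rintegral mu `[0%R, t] G) /G.
  rewrite (RintegralD mI (iD _ _ (iD _ _ (iZ p _ ig1') (iZ (- q) _ ig2')) ik) (iZ m _ il)).
  rewrite (RintegralD mI (iD _ _ (iZ p _ ig1') (iZ (- q) _ ig2')) ik).
  rewrite (RintegralD mI (iZ p _ ig1') (iZ (- q) _ ig2')).
  rewrite !(RintegralZl _ mI)// -/s Rintegral_cst//.
  rewrite [fine (mu _)](_ : _ = t); last first.
    by rewrite [X in fine X](lebesgue_measure_itv `[0, t]) /= lte_fin t0 /= subr0.
  have -> : (\int[mu]_(z in `[0%R, t]) g1 z)%R = - x by rewrite /Rintegral -g1E /= sub0r.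
  have -> : (\int[mu]_(z in `[0%R, t]) g2 z)%R = - y by rewrite /Rintegral -g2E /= sub0r.
  congr EFin; rewrite /phi_cost /k /m /p /q /=.
  by field; rewrite gt_eqF//= gt_eqF.
apply: ae_le_integral => //.
- apply/measurable_EFinP; apply: measurable_funD; last first.
    by apply/measurable_EFinP; exact: measurable_int iF.
  have m1 : measurable_fun `[0, t] (fun z => (eta z).1).
    by apply/measurable_EFinP; exact: measurable_int ie1.
  have m2 : measurable_fun `[0, t] (fun z => (eta z).2).
    by apply/measurable_EFinP; exact: measurable_int ie2.
  have -> : (fun z => costL c (- eta z)) = (fun z =>
      ((eta z).1 * (eta z).1 + (eta z).2 * (eta z).2) * 4^-1 + c / 2 * (eta z).1
      + (c ^+ 2 / 4 - 1)).
    by apply/funext => z; rewrite /costL /=; ring.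
  by do ?[apply: measurable_funD|apply: measurable_funM].
- exact: measurable_int iG.
- have F := ae_filter_ringOfSetsType mu.
  apply: filterS3 (filterI dg1 dg2) (filterI l_ge0 dyn) (filterI (ae_neq 0) (ae_neq t)).
  move=> z [d1 d2] [lz dz] [z0 zt] /=; rewrite in_itv /= => zI.
  have z0t : 0 < z < t by move: zI; rewrite !lt_neqAle zt eq_sym z0.
  have [lz0 _] := lz zI; have [free refl] := dz zI.
  rewrite lee_fin /G /k /m /costF (d1 z0t); rewrite (d1 z0t) (d2 z0t) in free refl.
  by have := running_cost_ge_affine b c p q a0 lz0 free refl; rewrite mulNr.
Qed.

End lower_bound.

(** * The trajectories of least action *)

Section upper_bound.
Context {R : realType}.
Set Implicit Arguments.
Unset Strict Implicit.
Unset Printing Implicit Defensive.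
Local Notation mu := (@lebesgue_measure R).

Lemma lipschitz_abs_continuous (u v K : R) (f : R -> R) :
  (forall x y, x <= y -> `|f y - f x| <= K * (y - x)) -> abs_continuous u v f.
Proof.
move=> fK e e0; have K0 : 0 < `|K| + 1 by rewrite ltr_wpDl.
exists (e / (`|K| + 1)); first by rewrite divr_gt0.
move=> n p q pq _; rewrite ltr_pdivlMr// => H; apply: le_lt_trans H.
rewrite mulr_suml; apply: ler_sum => i _; have [_ /ltW piqi _] := pq i.
apply: le_trans (fK _ _ piqi) _; rewrite mulrC ler_wpM2l ?subr_ge0//.
by rewrite (le_trans (ler_norm K))// lerDl.
Qed.

Lemma derive1_near_affine (f : R -> R) (z al be : R) :
  (\forall w \near z, f w = al + be * w) -> derive1 f z = be.
Proof.
move=> fE; rewrite derive1E (near_eq_derive _ fE).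
have h : is_derive z 1 (cst al + be *: (@id R)) (0 + be *: 1) by apply: is_deriveD.
by rewrite -[LHS]/('D_1 (cst al + be *: (@id R)) z) derive_val add0r scaler1.
Qed.

Lemma max0_lip (u v : R) : u <= v -> 0 <= Num.max 0 v - Num.max 0 u <= v - u.
Proof.
by move=> uv; case: (lerP 0 v) => ?; case: (lerP 0 u) => ?; apply/andP; split; lra.
Qed.

Section trajectory.
Variables (a b c x y t s : R).
Hypotheses (a0 : 0 < a) (y0 : 0 <= y) (t0 : 0 < t) (s0 : 0 <= s).

(* p and q are the slopes that are optimal in the lower bound; the velocity eta
   below is the one at which the affine minorant touches the cost. *)
Let p : R := (- x + b * s + c * t) / (2 * (t + a * s)).
Let q : R := (y + s) / (2 * t).
(* The time at which the path, descending from y at speed 2q, reaches the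
   boundary.  When y = s = 0 the quotient is 0 / 0 = 0; then q = 0 and the
   path stays on the boundary without reflection. *)
Let th := y * t / (y + s).

(* On the boundary the affine minorant touches the cost when eta_1 - gamma_1'
   equals (b - 2pa) l with l = 2q; this is the drift of gamma_1 after th. *)
Let gamma (z : R) : R * R :=
  (x + (2 * p - c) * z - (b - 2 * p * a) * (2 * q) * Num.max 0 (z - th),
   2 * q * Num.max 0 (th - z)).
Let eta (z : R) : R * R := (2 * p - c, - (2 * q)).
Let l z := 2 * q * \1_(`]th, +oo[) z.

Let q_ge0 : 0 <= q.
Proof. by rewrite divr_ge0 ?addr_ge0// mulr_ge0// ltW. Qed.

Let th_bounds : 0 <= th <= t.
Proof.
rewrite /th divr_ge0 ?mulr_ge0 ?addr_ge0 ?(ltW t0)//=.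
have [->|ys] := eqVneq (y + s) 0; first by rewrite invr0 mulr0 ltW.
by rewrite ler_pdivrMr ?lt_def ?ys ?addr_ge0// mulrC ler_pM2l// lerDl.
Qed.

Let qth : 2 * q * th = y.
Proof.
rewrite /q /th; have [ys|ys] := eqVneq (y + s) 0.
  have -> : y = 0 by apply/eqP; rewrite eq_le y0 andbT -ys lerDl.
  by rewrite !mul0r mulr0.
by field; rewrite ys gt_eqF.
Qed.

(* The reflection at rate 2q from th to t accumulates exactly s. *)
Let qt : 2 * q * (t - th) = s.
Proof.
by rewrite mulrBr qth /q; field; rewrite gt_eqF.
Qed.

Let lE z : l z = if th < z then 2 * q else 0.
Proof.
rewrite /l indicE; case: ifPn => h.
  by rewrite mem_set ?mulr1//= in_itv /= h.
by rewrite memNset ?mulr0//= in_itv /= andbT; exact/negP.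
Qed.

Let gamma_free z : z < th -> derive1 (fun w => (gamma w).1) z = 2 * p - c /\
  derive1 (fun w => (gamma w).2) z = - (2 * q).
Proof.
move=> zth; split.
  apply: (derive1_near_affine (al := x)); near=> w.
  have wth : w < th by near: w; exact: lt_nbhsl.
  by rewrite /= (max_idPl _) ?mulr0 ?subr0//; lra.
apply: (derive1_near_affine (al := 2 * q * th)); near=> w.
have wth : w < th by near: w; exact: lt_nbhsl.
by rewrite /= (max_idPr _) ?mulr0 ?subr0//; [ring|lra].
Unshelve. all: by end_near. Qed.

Let gamma_refl z : th < z ->
  derive1 (fun w => (gamma w).1) z = 2 * p - c - (b - 2 * p * a) * (2 * q) /\
  derive1 (fun w => (gamma w).2) z = 0.
Proof.
move=> zth; split.
  apply: (derive1_near_affine (al := x + (b - 2 * p * a) * (2 * q) * th)); near=> w.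
  have wth : th < w by near: w; exact: lt_nbhsr.
  by rewrite /= (max_idPr _) ?mulr0 ?subr0//; [ring|lra].
apply: (derive1_near_affine (al := 0)); near=> w.
have wth : th < w by near: w; exact: lt_nbhsr.
by rewrite /= (max_idPl _) ?mulr0 ?subr0//; [ring|lra].
Unshelve. all: by end_near. Qed.

Let costFE z : costF a b gamma eta l z = a * p ^+ 2 * l z.
Proof.
rewrite /costF lE; case: ifPn => [lz|]; last first.
  case: ifPn => _; last by rewrite mulr0.
  rewrite -leNgt => q0; have -> : 2 * q = 0 by apply/eqP; rewrite eq_le q0 mulr_ge0.
  by rewrite mulr0.
case: ifPn lz => [thz q0|]; last by rewrite ltxx.
have [-> _] := gamma_refl thz; rewrite /costG /=.
by field; rewrite !gt_eqF// -(pmulr_rgt0 q (ltr0Sn R 1)).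
Qed.

Let ml : measurable_fun `[0, t] l.
Proof. by apply: measurable_funM => //; exact: measurable_indic. Qed.

Let mI : measurable (`[0, t]%classic : set (measurableTypeR R)).
Proof. exact: measurable_itv. Qed.

Let muI : mu `[0, t]%classic = t%:E.
Proof. by rewrite [LHS](lebesgue_measure_itv `[0, t]) /= lte_fin t0 sube0. Qed.

Let bounded_int (f : R -> R) M : measurable_fun `[0, t] f -> (forall z, `|f z| <= M) ->
  mu.-integrable `[0, t] (EFin \o f).
Proof.
move=> mf fM; apply: measurable_bounded_integrable => //; first by rewrite [ltLHS]muI ltry.
exists M; split; [exact: num_real|move=> r Mr z _ /=].
by apply: le_trans (fM z) (ltW _).
Qed.

Let int_l : mu.-integrable `[0, t] (EFin \o l).
Proof.
apply: (@bounded_int _ (2 * q)) => // z; rewrite lE; case: ifP => _.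
  by rewrite ger0_norm// mulr_ge0.
by rewrite normr0 mulr_ge0.
Qed.

Let integral_l : (\int[mu]_(z in `[0%R, t]) l z = s)%R.
Proof.
rewrite RintegralZl//; last first.
  apply: (@bounded_int _ 1) => [|z]; first exact: measurable_indic.
  by rewrite indicE; case: (_ \in _); rewrite /= ?normr1 ?normr0.
rewrite /Rintegral integral_indic//.
have -> : `]th, +oo[ `&` `[0, t] = `]th, t]%classic.
  apply/seteqP; split => z /=; rewrite !in_itv /= andbT.
    by move=> [-> /andP[_ ->]].
  have /andP[h1 h2] := th_bounds => /andP[h3 h4]; split=> //.
  by rewrite h4 andbT; lra.
have /andP[h1 h2] := th_bounds.
rewrite [X in fine X](lebesgue_measure_itv `]th, t]) /= lte_fin.
case: ifPn => [_|]; first by rewrite /= qt.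
by rewrite -leNgt -qt => tth; rewrite /= (@le_anti _ _ th t) ?h2// subrr.
Qed.

Let gamma_control : control_triplet a b (x, y) t gamma eta l.
Proof.
have /andP[th0 tht] := th_bounds.
split.
- apply: (@lipschitz_abs_continuous _ _
    (`|2 * p - c| + `|(b - 2 * p * a) * (2 * q)|)) => u v uv /=.
  have /max0_lip/andP[h1 h2] : u - th <= v - th by rewrite lerB.
  set A := 2 * p - c; set B := (b - 2 * p * a) * (2 * q); clearbody A B.
  set m := Num.max 0 (v - th) in h1 h2 *; set m' := Num.max 0 (u - th) in h1 h2 *.
  have -> : x + A * v - B * m - (x + A * u - B * m') = A * (v - u) - B * (m - m') by ring.
  apply: le_trans (ler_normB _ _) _; rewrite !normrM mulrDl.
  have uv0 : 0 <= v - u by rewrite subr_ge0.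
  rewrite (ger0_norm h1) (ger0_norm uv0) lerD2l ler_wpM2l//.
  by apply: le_trans h2 _; rewrite opprB addrA subrK.
- apply: (@lipschitz_abs_continuous _ _ (2 * q)) => u v uv /=.
  have /max0_lip/andP[h1 h2] : th - v <= th - u by rewrite lerB.
  rewrite distrC -mulrBr normrM (ger0_norm h1).
  have q2 : 0 <= 2 * q by rewrite mulr_ge0.
  rewrite (ger0_norm q2) ler_wpM2l//.
  by apply: le_trans h2 _; rewrite opprB addrC addrA subrK.
- by move=> z _ /=; apply: mulr_ge0; [rewrite mulr_ge0|rewrite le_max lexx].
- apply: (@bounded_int _ `|2 * p - c|) => //.
- apply: (@bounded_int _ `|2 * q|) => // z; rewrite /= normrN//.
- exact: int_l.
- rewrite /gamma mulr0 addr0 sub0r (max_idPl _) ?oppr_le0// mulr0 subr0.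
  by rewrite subr0 (max_idPr _)// qth.
- apply: aeW => z _; rewrite lE; split; first by case: ifP => _ //; rewrite mulr_ge0.
  case: ifPn => // thz /=; rewrite (max_idPl _) ?mulr0 ?eqxx//; lra.
- have -> : (fun z => (costF a b gamma eta l z)%:E) =
     EFin \o (fun z => a * p ^+ 2 * l z).
    by apply/funext => z; rewrite /= costFE.
  exact: (integrableZl mI (a * p ^+ 2) int_l).
- apply: filterS (ae_neq th); first exact: (ae_filter_ringOfSetsType mu).
  move=> z zth _; rewrite lE; case: (ltrgtP z th) zth => // zth _.
    by have [-> ->] := gamma_free zth; split=> //; rewrite eqxx.
  have [-> ->] := gamma_refl zth; split => [q2|_ /=]; last by rewrite sub0r.
  by rewrite /= q2; split; rewrite ?mulr0 ?subr0// ?oppr0.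
Qed.

Let gamma_end : gamma t = (0, 0).
Proof.
have /andP[th0 tht] := th_bounds; rewrite /gamma; congr pair.
  rewrite (max_idPr _) ?subr_ge0// -[(b - _) * _ * _]mulrA qt /p.
  by field; rewrite gt_eqF// ltr_wpDr// mulr_ge0// ltW.
by rewrite (max_idPl _) ?mulr0// subr_le0.
Qed.

Let gamma_action :
  action a b c t gamma eta l = (phi_cost a b c (x, y) t s - t)%:E.
Proof.
have tas : 0 < t + a * s by rewrite ltr_wpDr// mulr_ge0// ltW.
pose k := p ^+ 2 + q ^+ 2 - 1.
have kE z : costL c (- eta z) + costF a b gamma eta l z = k + a * p ^+ 2 * l z.
  by rewrite costFE /costL /eta /k /=; field.
rewrite /action; under eq_integral do rewrite kE.
have ik : mu.-integrable `[0, t] (EFin \o (fun=> k)) by exact: (@bounded_int _ `|k|).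
have il : mu.-integrable `[0, t] (EFin \o (fun z => a * p ^+ 2 * l z)).
  exact: (integrableZl mI (a * p ^+ 2) int_l).
rewrite -[LHS]fineK; last exact: (integrable_fin_num mI (integrableD mI ik il)).
rewrite -/(Rintegral mu `[0%R, t] (fun z => k + a * p ^+ 2 * l z)).
rewrite (RintegralD mI ik il) Rintegral_cst// (RintegralZl _ mI int_l) integral_l.
rewrite [fine (mu _)](_ : _ = t); last by rewrite [X in fine X]muI.
congr EFin; rewrite /phi_cost /k /p /q /=.
by field; rewrite !gt_eqF.
Qed.

(** The only time at which gamma is not locally affine is th, a null set, so the
    constraints hold almost everywhere.  The position x enters through p, which
    is chosen so that the path arrives at 0 in the first coordinate. *)
Lemma reflected_trajectory : exists gamma eta l,
  [/\ control_triplet a b (x, y) t gamma eta l, gamma t = (0, 0) &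
      action a b c t gamma eta l = (phi_cost a b c (x, y) t s - t)%:E].
Proof.
by exists gamma, eta, l; split;
  [exact: gamma_control|exact: gamma_end|exact: gamma_action].
Qed.

End trajectory.

End upper_bound.

(** * The minimum of the cost and the value *)

Section minimum.
Context {R : realType}.
Set Implicit Arguments.
Unset Strict Implicit.
Unset Printing Implicit Defensive.

Lemma phi_cost_continuous (a b c : R) (x : R * R) (t s : R) :
  0 < a -> 0 < t -> 0 <= s -> {for s, continuous (phi_cost a b c x t)}.
Proof.
move=> a0 t0 s0; rewrite /phi_cost /continuous_at.
have den : 4 * (t + a * s) != 0 by rewrite gt_eqF// mulr_gt0// ltr_wpDr// mulr_ge0// ltW.
apply: cvgD; apply: cvgM; rewrite ?expr2.
- apply: cvgM; (apply: cvgD; last exact: cvg_cst);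
    (apply: cvgD; first exact: cvg_cst);
    by apply: cvgM; [exact: cvg_cst|exact: cvg_id].
- apply: cvgV => //; apply: cvgM; [exact: cvg_cst|].
  apply: cvgD; [exact: cvg_cst|]; apply: cvgM; [exact: cvg_cst|exact: cvg_id].
- by apply: cvgM; (apply: cvgD; [exact: cvg_cst|exact: cvg_id]).
- exact: cvg_cst.
Qed.

(** Since phi_cost s >= s^2 / (4t), the values beyond M := 1 + 4 t phi_cost 0 exceed
    phi_cost 0, and it suffices to minimise over [0, M]. *)
Lemma phi_cost_min (a b c x y t : R) :
  0 < a -> 0 < t -> 0 <= y ->
  exists2 s, 0 <= s & forall s', 0 <= s' ->
    phi_cost a b c (x, y) t s <= phi_cost a b c (x, y) t s'.
Proof.
move=> a0 t0 y0; set f := phi_cost a b c (x, y) t.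
have f_ge s : 0 <= s -> s ^+ 2 / (4 * t) <= f s.
  move=> s0; rewrite /f /phi_cost /= -[leLHS]add0r lerD//.
    by rewrite divr_ge0 ?sqr_ge0// mulr_ge0// addr_ge0 ?mulr_ge0// ltW.
  rewrite ler_pM2r ?invr_gt0 ?mulr_gt0// lerXn2r ?nnegrE ?addr_ge0//.
  by rewrite lerDr.
have f0 : 0 <= f 0 by apply: le_trans (f_ge 0 _); rewrite ?expr0n ?mul0r.
pose M := 1 + 4 * t * f 0.
have M1 : 1 <= M by rewrite lerDl !mulr_ge0// ltW.
have M0 : 0 <= M by apply: le_trans M1.
have cf : {within `[0, M], continuous f}.
  apply: continuous_in_subspaceT => s /set_mem/= sM.
  by apply: phi_cost_continuous => //; move: sM; rewrite in_itv /= => /andP[].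
have [s sM fs] := EVT_min M0 cf.
exists s; first by move: sM; rewrite in_itv /= => /andP[].
move=> s' s'0; have [s'M|Ms'] := lerP s' M.
  by apply: fs; rewrite in_itv /= s'0.
apply: (le_trans (fs 0 _)); first by rewrite in_itv /= lexx.
apply: le_trans (f_ge s' s'0); rewrite ler_pdivlMr ?mulr_gt0// mulrC.
apply: (@le_trans _ _ M); first by rewrite lerDr.
apply: (le_trans (ltW Ms')); rewrite expr2 ler_peMr//.
by apply: le_trans M1 (ltW Ms').
Qed.

End minimum.

Theorem theorem3 (R : realType) (a b c : R) (ha : 0 < a) (hb : 0 < b)
    (hc : 0 < c) (x y t : R) (hy : 0 <= y) (ht : 0 < t) :
  (exists s : R, [/\ 0 <= s, phi_cost a b c (x, y) t s = phi_star a b c (x, y) t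
     & forall s' : R, 0 <= s' ->
         phi_star a b c (x, y) t <= phi_cost a b c (x, y) t s'])
  /\ value_J a b c (x, y) t = (phi_star a b c (x, y) t - t)%:E.
Proof.
have [s s0 smin] := phi_cost_min b c x ha ht hy.
have phiE : phi_star a b c (x, y) t = phi_cost a b c (x, y) t s.
  apply/le_anti/andP; split.
    apply: ge_inf; last by exists s.
    by exists (phi_cost a b c (x, y) t s) => _ [s' s'0 <-]; exact: smin.
  apply: lb_le_inf; first by exists (phi_cost a b c (x, y) t s); exists s.
  by move=> _ [s' s'0 <-]; exact: smin.
split; first by exists s; rewrite phiE; split.
rewrite phiE; apply/le_anti/andP; split.
- have [gamma [eta [l [ct gt <-]]]] := reflected_trajectory b c x ha hy ht s0.
  by apply: ereal_inf_lbound; exists gamma, eta, l.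
- apply: le_ereal_inf_tmp => _ [gamma [eta [l [ct gt ->]]]].
  have [s' s'0 H] := action_ge c ha ht ct gt.
  apply: le_trans H; rewrite lee_fin lerD2r; exact: smin.
Qed.
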